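(* Let $d\ge 1$ and let $c_1,\dots,c_d$ be elements of an integral domain $R$ containing $\mathbb{Q}$ (e.g. $R=\mathbb{C}$), with $c_d\neq 0$. Let $(a_n)_{n\ge 0}$ be a sequence in $R$ satisfying $a_n=c_1a_{n-1}+\dots+c_da_{n-d}$ for all $n\ge d$. Let $(\hat a_n)_{n\ge0}$ be the Lucas transform of $(c_1,\dots,c_d)$, i.e. \[\hat a_0=d,\qquad \hat a_n=\sum_{k=1}^n\frac{(k-1)!}{(n-1)!}B_{n,k}(1!c_1,2!c_2,\dots,d!c_d,0,0,\dots)\ \text{ for } n\ge1.\] Then for any fixed $m\in\mathbb{N}=\{1,2,\dots\}$ and $r\in\mathbb{N}_0=\{0,1,2,\dots\}$, the subsequence $(a_{mn+r})_n$ satisfies \[a_{mn+r}=\gamma_1a_{m(n-1)+r}+\gamma_2a_{m(n-2)+r}+\dots+\gamma_da_{m(n-d)+r}\quad\text{for } n\ge d,\] where for $k=1,\dots,d$, \[\gamma_k=\sum_{j=1}^k\frac{(-1)^{j+1}}{k!}B_{k,j}\big(0!\hat a_m,1!\hat a_{2m},\dots,(k-j)!\hat a_{(k-j+1)m}\big).\]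
   Context: $B_{n,k}(x_1,x_2,\dots)$ denotes the $(n,k)$-th partial (exponential) Bell polynomial in the variables $x_1,\dots,x_{n-k+1}$, defined by $\sum_{n\ge k}B_{n,k}(x_1,x_2,\dots)\frac{t^n}{n!}=\frac{1}{k!}\Big(\sum_{i\ge1}x_i\frac{t^i}{i!}\Big)^k$. In the Lucas transform, the arguments beyond position $d$ are zero. *)

(* Defs.v *)
From HB Require Import structures.
From mathcomp Require Import all_boot all_order all_algebra.

Set Implicit Arguments.
Unset Strict Implicit.
Unset Printing Implicit Defensive.

Import GRing.Theory.
Local Open Scope ring_scope.

(* Indeterminates and coefficients are numbered from 1, as functions on [nat]
   whose value at 0 is never read. *)

Section Bell.
Variable R : idomainType.
Implicit Type x : nat -> R.

(* The series sum_(i >= 1) x_i t^i / i!, cut off after degree N. *)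
Definition egf_trunc x (N : nat) : {poly R} :=
  \sum_(1 <= i < N.+1) (x i / i`!%:R) *: 'X^i.

(* n! times the coefficient of t^n in (sum_(i >= 1) x_i t^i / i!)^k / k!.
   Terms of degree > n do not reach that coefficient, so the series may be cut
   off at degree n; [bell_genfun] shows that a later cut-off changes nothing.
   This is the Bell polynomial only where factorials are invertible in R. *)
Definition bell (n k : nat) x : R :=
  n`!%:R * ((k`!%:R)^-1 *: (egf_trunc x n) ^+ k)`_n.

Lemma coef_egf_trunc x N i :
  (egf_trunc x N)`_i = if (0 < i <= N)%N then x i / i`!%:R else 0.
Proof.
rewrite /egf_trunc coef_sum.
under eq_bigr => j _ do rewrite coefZ coefXn.
case: ifP => [Hi|Hi].
  rewrite (bigD1_seq i) ?mem_index_iota ?iota_uniq //= eqxx mulr1 big1 ?addr0 //.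
  by move=> j; rewrite eq_sym => /negPf->; rewrite mulr0.
rewrite big_nat big1 // => j Hj; case: eqP => [E|_]; last by rewrite mulr0.
by move: Hi; rewrite E; rewrite ltnS in Hj; rewrite Hj.
Qed.

Lemma coef_exp_eq (p q : {poly R}) n k :
  (forall i, (i <= n)%N -> p`_i = q`_i) ->
  forall i, (i <= n)%N -> (p ^+ k)`_i = (q ^+ k)`_i.
Proof.
move=> E; elim: k => [|k IH] i Hi; first by rewrite !expr0.
rewrite !exprS !coefM; apply: eq_bigr => j _.
have Hj : (j <= i)%N by rewrite -ltnS.
by rewrite E ?(leq_trans Hj) // IH // (leq_trans (leq_subr _ _)).
Qed.

Lemma bell_genfun (iota : {rmorphism rat -> R}) x n k N : (n <= N)%N ->
  bell n k x / n`!%:R = ((k`!%:R)^-1 *: (egf_trunc x N) ^+ k)`_n.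
Proof.
move=> nN; rewrite /bell mulrC mulKr; last first.
  rewrite -(rmorph_nat iota) rmorph_unit // unitfE.
  by rewrite Num.Theory.pnatr_eq0 -lt0n fact_gt0.
rewrite !coefZ; congr (_ * _).
apply: (@coef_exp_eq _ _ n) => // i Hi.
by rewrite !coef_egf_trunc Hi (leq_trans Hi nN).
Qed.

Definition lucas_args (d : nat) (c : nat -> R) (i : nat) : R :=
  if (i <= d)%N then i`!%:R * c i else 0.

Definition lucas_transform (d : nat) (c : nat -> R) (n : nat) : R :=
  if n == 0%N then d%:R
  else \sum_(1 <= k < n.+1)
         (k.-1)`!%:R / (n.-1)`!%:R * bell n k (lucas_args d c).

(* B_{k,j} involves only the arguments at i = 1, ..., k - j + 1. *)
Definition gamma (ahat : nat -> R) (m k : nat) : R :=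
  \sum_(1 <= j < k.+1)
     (-1) ^+ j.+1 / k`!%:R *
     bell k j (fun i => (i.-1)`!%:R * ahat (i * m)%N).

End Bell.

(* Main.v *)
(* Let e_k be the coefficients of det(1 - t A), the reversed characteristic
   polynomial of a matrix A. Newton's identities k e_k = - sum_i e_(k-i) tr(A^i)
   say that det(1 - t A) = exp(- sum_i tr(A^i) t^i / i); in characteristic 0
   either of the sequences (e_k) and (tr A^i) determines the other.
   For the companion matrix C of the recurrence, the Lucas transform consists of
   the coefficients of - t d/dt log(1 - sum_i c_i t^i), so it is tr(C^n). For
   A = C^m, the formula for gamma_k is minus the coefficient of t^k in
   exp(- sum_i tr(C^(i m)) t^i / i), so -gamma_k are the coefficients of the
   characteristic polynomial of C^m. Cayley-Hamilton for C^m, applied to the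
   column of consecutive terms of (a_n), is the asserted recurrence. *)
Require Import Defs.
From HB Require Import structures.
From mathcomp Require Import all_boot all_order all_algebra.
From mathcomp Require Import perm.

Set Implicit Arguments.
Unset Strict Implicit.
Unset Printing Implicit Defensive.

Import GRing.Theory.
Local Open Scope ring_scope.

(** * Newton's identities as a relation between two sequences *)

Definition newton (R : nzRingType) (e p : nat -> R) :=
  e 0%N = 1 /\
  forall k, k.+1%:R * e k.+1 = - \sum_(i < k.+1) p i.+1 * e (k - i)%N.

Lemma eq_newton (R : nzRingType) (e f p q : nat -> R) :
  e =1 f -> p =1 q -> newton e p -> newton f q.
Proof.
move=> ef pq [e0 ep]; split=> [|k]; first by rewrite -ef.
by rewrite -ef ep; congr (- _); apply: eq_bigr => i _; rewrite ef pq.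
Qed.

(** The last summand carries the factor [e 0 = 1], so each power sum is determined by the earlier
    ones without division. *)
Lemma newton_power_sums (R : nzRingType) (e p q : nat -> R) :
  newton e p -> newton e q -> forall k, (0 < k)%N -> p k = q k.
Proof.
move=> [e0 ep] [_ eq] [//|k] _; elim/ltn_ind: k => k IH.
have := ep k; rewrite eq !big_ord_recr /= subnn e0 !mulr1 => /oppr_inj.
under eq_bigr => i _ do rewrite -IH //.
by move/addrI->.
Qed.

Lemma newton_elementary (R : idomainType) (e f p : nat -> R) :
  (forall n, n.+1%:R != 0 :> R) ->
  newton e p -> newton f p -> e =1 f.
Proof.
move=> nz [e0 ep] [f0 fp] k; elim/ltn_ind: k => -[|k] IH; first by rewrite e0 f0.
apply: (mulfI (nz k)); rewrite ep fp; congr (- _); apply: eq_bigr => i _.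
by rewrite IH // ltnS leq_subr.
Qed.

(** * Newton's identities for characteristic polynomials *)

Lemma deriv_prod (R : comNzRingType) (I : finType) (F : I -> {poly R}) :
  (\prod_i F i)^`() = \sum_i (F i)^`() * \prod_(j | j != i) F j.
Proof.
suff H (r : seq I) : uniq r -> (\prod_(i <- r) F i)^`() =
    \sum_(i <- r) (F i)^`() * \prod_(j <- r | j != i) F j.
  exact: H (index_enum_uniq I).
elim: r => [|x r IH] /=; first by rewrite !big_nil -[1]/(1%:P) derivC.
case/andP=> xr ur; rewrite !big_cons derivM IH // eqxx /=; congr (_ * _ + _).
  rewrite [RHS]big_seq_cond [LHS]big_seq; apply: eq_bigl => j.
  by case: eqP => [->|_]; rewrite ?(negPf xr) ?andbT.
rewrite mulr_sumr [LHS]big_seq [RHS]big_seq; apply: eq_bigr => i ir.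
rewrite big_cons; case: eqP ir xr => [-> ->//|_ _ _]; exact: mulrCA.
Qed.

(** Jacobi's formula. By the product rule the derivative is the sum over i of the determinants with
    row i differentiated; expanding each along that row gives cofactors of [M] itself, since they do
    not see row i. *)
Lemma deriv_det (R : comNzRingType) n (M : 'M[{poly R}]_n) :
  (\det M)^`() = \tr (\adj M *m map_mx (@deriv R) M).
Proof.
pose M' (i : 'I_n) : 'M[{poly R}]_n := \matrix_(k, j)
  if k == i then (M k j)^`() else M k j.
transitivity (\sum_i \det (M' i)).
  rewrite /determinant raddf_sum exchange_big /=; apply: eq_bigr => s _.
  rewrite -mulr_sumr.
  have -> : ((-1) ^+ s : {poly R}) = ((-1) ^+ s)%:P by rewrite rmorphXn rmorphN1.
  rewrite deriv_mulC deriv_prod; congr (_ * _); apply: eq_bigr => i _.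
  rewrite [RHS](bigD1 i) //= mxE eqxx; congr (_ * _); apply: eq_bigr => j /negPf ji.
  by rewrite mxE ji.
rewrite mxtrace_mulC; apply: eq_bigr => i _.
rewrite (expand_det_row _ i) mxE; apply: eq_bigr => j _.
rewrite !mxE eqxx; congr (_ * (_ * \det _)).
by apply/matrixP=> k l; rewrite !mxE eq_sym (negPf (neq_lift _ _)).
Qed.

Lemma deriv_char_poly (R : comNzRingType) n (A : 'M[R]_n) :
  (char_poly A)^`() = \tr (\adj (char_poly_mx A)).
Proof.
rewrite deriv_det; congr (\tr _); rewrite -[RHS]mulmx1; congr (_ *m _).
apply/matrixP=> i j; rewrite !mxE derivB derivC subr0 derivMn derivX.
by case: eqP.
Qed.

Lemma size_det_linear (R : comNzRingType) n (M : 'M[{poly R}]_n) :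
  (forall i j, size (M i j) <= 2)%N -> (size (\det M) <= n.+1)%N.
Proof.
move=> sM; apply: (leq_trans (size_sum _ _ _)); apply/bigmax_leqP => s _.
have -> : ((-1) ^+ s : {poly R}) = ((-1) ^+ s)%:P by rewrite rmorphXn rmorphN1.
rewrite mul_polyC; apply: (leq_trans (size_scale_leq _ _)).
apply: (leq_trans (size_poly_prod_leq _ _)).
rewrite leq_subLR card_ord addnS ltnS.
apply: (leq_trans (leq_sum _ (E2 := fun=> 2%N) _)) => //.
by rewrite sum_nat_const card_ord muln2 addnn.
Qed.

Lemma size_adj_char_poly_mx (R : comNzRingType) n (A : 'M[R]_n) i j :
  (size (\adj (char_poly_mx A) i j) <= n)%N.
Proof.
case: n A i j => [|n] A i j; first by case: i.
rewrite mxE /cofactor.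
have -> k : ((-1) ^+ k : {poly R}) = ((-1) ^+ k)%:P by rewrite rmorphXn rmorphN1.
rewrite mul_polyC; apply: (leq_trans (size_scale_leq _ _)).
apply: size_det_linear => k l; rewrite !mxE.
case: eqP => _; rewrite ?mulr0n ?mulr1n ?sub0r ?size_polyN ?size_XsubC //.
exact: leq_trans (size_polyC_leq1 _) _.
Qed.

(* e_k is written as the coefficient of X^(n+1) in chi * X^k because this is
   chi_(n+1-k) when k <= n + 1, and 0 otherwise. The identity comes from
   chi' = tr(adj(X - A)) and X^(N+1) - A^(N+1) = (X - A) sum_i X^(N-i) A^i. *)
Lemma newton_char_poly (R : comNzRingType) n (A : 'M[R]_n.+1) :
  newton (fun k => (char_poly A * 'X^k)`_n.+1) (fun k => \tr (A ^+ k)).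
Proof.
have chi_n : (char_poly A)`_n.+1 = 1.
  by have /monicP := char_poly_monic A; rewrite lead_coefE size_char_poly.
split=> [|k]; first by rewrite mulr1.
set N := k.+1; set chi := char_poly A.
pose Ap := map_mx (@polyC R) A; pose B := \adj (char_poly_mx A).
have mapX i : Ap ^+ i = map_mx (@polyC R) (A ^+ i) by rewrite /Ap -rmorphXn.
have comm : GRing.comm ('X%:M) Ap by apply: comm_mx_sym; exact: comm_mx_scalar.
have scalX i : ('X^i)%:M = 'X%:M ^+ i :> 'M[{poly R}]_n.+1 by rewrite rmorphXn.
have H : 'X^(N.+1) * (char_poly A)^`() - \tr (B *m Ap ^+ N.+1) =
    \sum_(i < N.+1) chi * 'X^(N - i) * (\tr (A ^+ i))%:P.
  rewrite deriv_char_poly -/B -mxtraceZ -mul_mx_scalar scalX -raddfB -mulmxBr.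
  rewrite subrXX_comm // mulmxA -/(char_poly_mx A) mul_adj_mx mul_scalar_mx.
  rewrite /= mxtraceZ raddf_sum mulr_sumr; apply: eq_bigr => i _ /=.
  rewrite -mulrA; congr (_ * _).
  rewrite -scalX [_ * _]mul_scalar_mx mxtraceZ mapX; congr (_ * _).
  by rewrite trace_map_mx.
(* The adjugate has entries of degree at most n and [Ap ^+ N.+1] has constant entries, so degree n +
   1 is not reached. *)
have trB0 : (\tr (B *m Ap ^+ N.+1))`_n.+1 = 0.
  rewrite coef_sum big1 // => i _; rewrite mxE coef_sum big1 // => j _.
  rewrite mapX [map_mx _ _ _ _]mxE coefMC nth_default ?mul0r //.
  exact: size_adj_char_poly_mx.
have := congr1 (fun q : {poly R} => q`_n.+1) H.
rewrite coefB trB0 subr0 coef_sum big_ord_recl coefMC subn0 expr0 mxtrace1.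
under eq_bigr => i _ do rewrite coefMC lift0 subSS mulrC.
set S := \sum_(i < _) _; move=> E.
(* The summand i = 0 contributes e_N tr(1) = (n + 1) e_N. The left side of [H] contributes (n + 1 -
   N) e_N, also for N > n, where it is 0: the factor vanishes if N = n + 1, and e_N does beyond
   that. *)
have {}E : (chi * 'X^N)`_n.+1 * n.+1%:R + S =
    (chi * 'X^N)`_n.+1 * n.+1%:R - N%:R * (chi * 'X^N)`_n.+1.
  rewrite -E coefXnM coefMXn coef_deriv ltnS -/chi; move: (chi) => q.
  case: (ltngtP n k) => [lt_nk|lt_kn|->].
  - by rewrite /N !ltnS (ltnW lt_nk) lt_nk mul0r mulr0 subr0.
  - rewrite /N !ltnS leqNgt lt_kn ltnNge (ltnW lt_kn) /= !subSS subnSK //.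
    by rewrite [q`__ * _]mulrC -mulrBl -natrB ?subSS ?mulr_natl // ltnS ltnW.
  - by rewrite /N !ltnS leqnn ltnn mulrC subrr.
by move/addrI: E => ->; rewrite opprK.
Qed.

(** * Sums of Bell polynomials as coefficients of truncated logarithms and exponentials *)

Section CharZero.
Variables (R : idomainType) (iota : {rmorphism rat -> R}).

Lemma natr_unit n : n.+1%:R \is a @GRing.unit R.
Proof.
by rewrite -(rmorph_nat iota) rmorph_unit // unitfE Num.Theory.pnatr_eq0.
Qed.

Lemma natr_neq0 n : n.+1%:R != 0 :> R.
Proof. by apply: contraTneq (natr_unit n) => ->; rewrite unitr0. Qed.

Lemma fact_unit n : n`!%:R \is a @GRing.unit R.
Proof. by rewrite -(prednK (fact_gt0 n)) natr_unit. Qed.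

Lemma coef_exp_small (p : {poly R}) n k : p`_0 = 0 -> (n < k)%N -> (p ^+ k)`_n = 0.
Proof.
move=> p0 nk; have /factor_theorem[q ->] : root p 0 by rewrite /root horner_coef0 p0.
by rewrite subr0 exprMn coefMXn nk.
Qed.

Lemma egf_trunc0 (x : nat -> R) N : (egf_trunc x N)`_0 = 0.
Proof. by rewrite coef_egf_trunc. Qed.

(** Such a sum is a coefficient of the composite of sum_j w_j t^j / j! with the series of [x]; the
    series has no constant term, so powers above n do not contribute. Weights (j-1)! give -log(1 -
    P), weights (-1)^j give exp(-P). *)
Lemma sum_bell (x w : nat -> R) n N : (n <= N)%N ->
  \sum_(1 <= j < n.+1) w j / n`!%:R * bell n j x =
  (\sum_(1 <= j < N.+1) (w j / j`!%:R) *: egf_trunc x N ^+ j)`_n.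
Proof.
move=> nN; rewrite coef_sum [RHS](big_cat_nat (n := n.+1)) //=.
rewrite [X in _ = _ + X]big_nat [X in _ = _ + X]big1 ?addr0; last first.
  by move=> j /andP[nj _]; rewrite coefZ coef_exp_small ?mulr0 ?egf_trunc0.
apply: eq_bigr => j _.
by rewrite mulrAC -mulrA (bell_genfun iota _ _ nN) !coefZ mulrA.
Qed.

Lemma deriv_log_trunc (P : {poly R}) N :
  (\sum_(1 <= j < N.+1) j%:R^-1 *: P ^+ j)^`() * (1 - P) = P^`() * (1 - P ^+ N).
Proof.
elim: N => [|N IH]; first by rewrite big_nil linear0 mul0r expr0 subrr mulr0.
rewrite big_nat_recr //= derivD mulrDl IH derivZ deriv_exp -scaler_nat scalerA.
rewrite mulVr ?natr_unit // scale1r -mulrA -mulrDr exprSr; congr (_ * _).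
by rewrite mulrBr mulr1 addrA subrK.
Qed.

Lemma deriv_exp_trunc (P : {poly R}) N :
  (\sum_(0 <= j < N.+2) ((-1) ^+ j / j`!%:R) *: P ^+ j)^`() =
  - (P^`() * \sum_(0 <= j < N.+1) ((-1) ^+ j / j`!%:R) *: P ^+ j).
Proof.
rewrite raddf_sum big_nat_recl // expr0 /= derivZ (derivC 1) scaler0 add0r.
rewrite mulr_sumr -sumrN; apply: eq_bigr => j _.
rewrite derivZ deriv_exp -scaler_nat scalerA factS natrM invrM ?fact_unit ?natr_unit //=.
by rewrite mulrA mulrVK ?natr_unit // exprS mulN1r mulNr scaleNr scalerAr.
Qed.

Lemma lucas_coef d (c : nat -> R) n N : (0 < n <= N)%N ->
  lucas_transform d c n =
  n%:R * (\sum_(1 <= j < N.+1) j%:R^-1 *: egf_trunc (lucas_args d c) N ^+ j)`_n.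
Proof.
case: n => [//|n] /= nN; rewrite /lucas_transform /=.
have -> : \sum_(1 <= j < N.+1) j%:R^-1 *: egf_trunc (lucas_args d c) N ^+ j =
  \sum_(1 <= j < N.+1) ((j.-1)`!%:R / j`!%:R) *: egf_trunc (lucas_args d c) N ^+ j.
  rewrite big_nat [RHS]big_nat; apply: eq_bigr => -[//|j] _ /=; congr (_ *: _).
  by rewrite factS natrM invrM ?fact_unit ?natr_unit // mulrA divrr ?fact_unit // mul1r.
rewrite -(@sum_bell _ (fun j => (j.-1)`!%:R)) // mulr_sumr; apply: eq_bigr => j _.
rewrite [RHS]mulrA; congr (_ * bell _ _ _).
by rewrite factS natrM invrM ?fact_unit ?natr_unit // [RHS]mulrC !mulrA mulrVK ?natr_unit.
Qed.

(** The coefficients of 1 - sum_i c_i t^i. *)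
Definition char_coef d (c : nat -> R) k : R :=
  if k == 0%N then 1 else if (k <= d)%N then - c k else 0.

Lemma coef_egf_lucas d (c : nat -> R) N k : (k <= N)%N ->
  (1 - egf_trunc (lucas_args d c) N)`_k = char_coef d c k.
Proof.
move=> kN; rewrite coefB coef1 coef_egf_trunc kN andbT /char_coef lt0n.
case: eqP => [_|_] /=; first by rewrite subr0.
rewrite sub0r /lucas_args; case: leqP; rewrite ?mul0r ?oppr0 //.
by rewrite mulrAC divrr ?fact_unit // mul1r.
Qed.

(** Compare coefficients of t^k in L' (1 - P) = P' (1 - P^N), where L truncates -log(1 - P): L'
    yields the Lucas transform, P' yields -(k+1) e_(k+1), and P^N starts only in degree N > k. *)
Lemma newton_lucas d (c : nat -> R) :
  newton (char_coef d c) (lucas_transform d c).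
Proof.
split=> [//|k]; pose N := k.+2; pose P := egf_trunc (lucas_args d c) N.
pose L := \sum_(1 <= j < N.+1) j%:R^-1 *: P ^+ j.
have := congr1 (fun q : {poly R} => q`_k) (deriv_log_trunc P N).
rewrite -/L [P^`() * _]mulrBr mulr1 coefB [X in _ = _ - X]coefM.
rewrite [X in _ = _ - X]big1 ?subr0; last first.
  move=> j _; rewrite coef_exp_small ?mulr0 ?egf_trunc0 //.
  by rewrite ltnS (leq_trans (leq_subr _ _)).
rewrite coefM coef_deriv => E.
rewrite -(@coef_egf_lucas d c N) // coefB coef1 sub0r mulrN mulr_natl -E.
congr (- _); apply: eq_bigr => -[i /= ik] _.
rewrite coef_deriv -mulr_natl -(@coef_egf_lucas d c N); last first.
  by rewrite (leq_trans (leq_subr _ _)) // leqW.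
by rewrite (@lucas_coef d c i.+1 N) //= leqW.
Qed.

(** This is E' = -P' E for E = exp(-P) and P = sum_i p(im) t^i / i, the weight 1/i being
    (i-1)!/i!. *)
Lemma newton_gamma (p : nat -> R) m :
  newton (fun k => if k == 0%N then 1 else - gamma p m k) (fun k => p (k * m)%N).
Proof.
split=> [//|k]; pose N := k.+1.
pose x i := (i.-1)`!%:R * p (i * m)%N; pose P := egf_trunc x N.
pose E n := \sum_(0 <= j < n.+1) ((-1) ^+ j / j`!%:R) *: P ^+ j.
(* The cut-off K is left free because [deriv_exp_trunc] has one term fewer on its right side. *)
have eE n K : (n <= K <= N)%N -> (if n == 0%N then 1 else - gamma p m n) = (E K)`_n.
  case/andP=> nK KN; have EN : (E K)`_n = (E N)`_n.
    rewrite /E [in RHS](big_cat_nat (n := K.+1)) //= coefD [X in _ = _ + X]coef_sum.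
    rewrite [X in _ = _ + X]big_nat [X in _ = _ + X]big1 ?addr0 // => j /andP[Kj _].
    by rewrite coefZ coef_exp_small ?mulr0 ?egf_trunc0 // (leq_ltn_trans nK).
  rewrite EN /E big_nat_recl // expr0 coefD coefZ coef1 divr1.
  rewrite -(big_add1 _ _ 0 N.+1 xpredT (fun j => ((-1) ^+ j / j`!%:R) *: P ^+ j)).
  rewrite -(@sum_bell x (fun j => (-1) ^+ j)) ?(leq_trans nK) //.
  case: n {nK EN} => [|n] /=; first by rewrite big_nil addr0 mulr1.
  rewrite mulr0 add0r /gamma -sumrN; apply: eq_bigr => j _.
  by rewrite exprS !mulN1r !mulNr opprK.
have := congr1 (fun q : {poly R} => q`_k) (deriv_exp_trunc P k).
rewrite -/(E k.+1) -/(E k) coef_deriv coefN coefM -(eE k.+1 k.+1) ?leqnn //= => dE.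
rewrite mulr_natl dE.
congr (- _); apply: eq_bigr => -[i /= ik] _.
rewrite -(eE (k - i)%N k) ?leq_subr ?leqnSn //; congr (_ * _).
rewrite coef_deriv coef_egf_trunc ik /x /= factS natrM -[LHS]mulr_natr.
rewrite invrM ?fact_unit ?natr_unit // mulrA mulrVK ?natr_unit //.
by rewrite mulrAC divrr ?fact_unit // mul1r.
Qed.
End CharZero.

(** * The companion matrix and the recurrence for the subsequence *)

Lemma char_poly_companion (R : comNzRingType) d (p : {poly R}) :
  p \is monic -> size p = d.+1 ->
  char_poly (\matrix_(i < d, j < d)
    if (i == d.-1 :> nat) then - p`_j else (i.+1 == j :> nat)%:R) = p.
Proof.
move=> mp sp; have {sp} -> : d = (size p).-1 by rewrite sp.
exact: companionmxK.
Qed.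

Lemma horner_mx_sum (R : comNzRingType) n (A : 'M[R]_n.+1) (q : {poly R}) N :
  (size q <= N)%N -> horner_mx A q = \sum_(i < N) q`_i *: A ^+ i.
Proof.
move=> sq; rewrite -[q in LHS](coefK q).
have -> : \poly_(i < size q) q`_i = \sum_(i < N) q`_i *: 'X^i.
  rewrite -poly_def; apply/polyP => i; rewrite !coef_poly.
  case: ltnP => [iq|qi]; first by rewrite (leq_trans iq).
  by rewrite (nth_default _ qi) if_same.
rewrite raddf_sum; apply: eq_bigr => i _ /=.
by rewrite linearZ /= rmorphXn /= horner_mx_X.
Qed.

Theorem theorem1 (R : idomainType) (iota : {rmorphism rat -> R})
  (d : nat) (hd : (1 <= d)%N)
  (c : nat -> R) (hcd : c d != 0)
  (a : nat -> R)
  (ha : forall n : nat, (d <= n)%N ->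
          a n = \sum_(1 <= i < d.+1) c i * a (n - i)%N)
  (m r : nat) (hm : (1 <= m)%N) :
  forall n : nat, (d <= n)%N ->
    a (m * n + r)%N =
      \sum_(1 <= k < d.+1)
         gamma (lucas_transform d c) m k * a (m * (n - k) + r)%N.
Proof.
case: d hd hcd ha => [//|d] _ _ ha n dn.
pose e := char_coef d.+1 c.
(* The order is now [d.+1], and [p] is X^(d+1) - sum_i c_i X^(d+1-i). *)
pose p := \poly_(i < d.+2) e (d.+1 - i)%N.
have p_top : p`_d.+1 = 1 by rewrite coef_poly leqnn subnn.
have sp : size p = d.+2 by rewrite size_poly_eq // subnn oner_neq0.
have mp : p \is monic by rewrite monicE lead_coefE sp p_top.
have := char_poly_companion mp sp; set C := \matrix_(_, _) _ => chiC.
pose v n := \col_(i < d.+1) a (n + i)%N.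
(* The last row of [C] is the recurrence in reversed order; the other rows shift the window of
   terms. *)
have Cv t : C *m v t = v t.+1.
  apply/colP => i; rewrite !mxE addSnnS; case: (i =P d :> nat) => [id|/eqP id].
    rewrite id ha ?leq_addl // big_add1 big_mkord (reindex_inj rev_ord_inj).
    apply: eq_bigr => j _; rewrite !mxE /= id eqxx coef_poly ltnS leq_subr.
    by rewrite subKn // /e /char_coef /= ltn_ord opprK addnBA.
  have id1 : (i.+1 < d.+1)%N by rewrite ltnS ltn_neqAle id -ltnS ltn_ord.
  rewrite (bigD1 (Ordinal id1)) //= !mxE (negPf id) eqxx mul1r big1 ?addr0 //.
  move=> j ji; rewrite !mxE (negPf id) /=; case: eqP => [E|_]; last exact: mul0r.
  by case/eqP: ji; apply: val_inj.
have vC s t : C ^+ s *m v t = v (t + s)%N.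
  elim: s t => [|s IH] t; first by rewrite mul1mx addn0.
  by rewrite exprSr -mulmxA -addSnnS -IH Cv.
have eC k : (char_poly C * 'X^k)`_d.+1 = e k.
  rewrite chiC coefMXn coef_poly; case: ltnP => kd.
    by rewrite /e /char_coef leqNgt kd; case: k kd.
  by rewrite ltnS leq_subr subKn.
have trC i : \tr (C ^+ i) = lucas_transform d.+1 c i.
  (* Newton's identities say nothing about index 0, where both sides are d + 1. *)
  case: i => [|i]; first by rewrite mxtrace1.
  have newtonC := eq_newton eC (fun=> erefl) (newton_char_poly C).
  exact: newton_power_sums newtonC (newton_lucas iota d.+1 c) _ (ltn0Sn i).
have chiCm k : (char_poly (C ^+ m) * 'X^k)`_d.+1 =
    if k == 0%N then 1 else - gamma (lucas_transform d.+1 c) m k.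
  move: k; apply: (newton_elementary (natr_neq0 iota) (newton_char_poly (C ^+ m))).
  apply: eq_newton (newton_gamma iota (lucas_transform d.+1 c) m) => // k.
  by rewrite -exprM mulnC trC.
have := Cayley_Hamilton (C ^+ m).
rewrite (@horner_mx_sum _ _ _ _ d.+2) ?size_char_poly //.
(* With the window starting at m(n-d-1) + r, the power (C^m)^(d+1-k) brings a(m(n-k) + r) to its
   first entry. *)
move/(congr1 (fun M => (M *m v (m * (n - d.+1) + r)%N) ord0 ord0)).
rewrite mul0mx [RHS]mxE mulmx_suml summxE (reindex_inj rev_ord_inj) big_ord_recl /=.
have term (k : nat) : (k <= d.+1)%N ->
    ((char_poly (C ^+ m))`_(d.+1 - k) *: C ^+ m ^+ (d.+1 - k) *m
       v (m * (n - d.+1) + r)%N) ord0 ord0 =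
    (char_poly (C ^+ m) * 'X^k)`_d.+1 * a (m * (n - k) + r)%N.
  move=> kd; rewrite coefMXn ltnNge kd /= -scalemxAl -exprM vC !mxE addn0.
  by rewrite addnAC -mulnDr addnBA // subnK.
rewrite subSS term // chiCm mul1r subn0.
under eq_bigr => i _ do rewrite /bump leq0n add1n subSS term // chiCm mulNr.
by rewrite sumrN => /eqP; rewrite subr_eq0 => /eqP ->; rewrite big_add1 big_mkord.
Qed.
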